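(* For all integers $N\ge 0$ and $n\ge 1$, $$\widehat E_{N,n}=n!\sum_{k=1}^n(-1)^k\sum_{\substack{i_1,\dots,i_k\ge 1\\ i_1+\cdots+i_k=n/2}}\frac{\bigl((2N+1)!\bigr)^k}{(2N+2i_1+1)!\cdots(2N+2i_k+1)!}$$ and $$\widehat E_{N,n}=n!\sum_{k=1}^n(-1)^k\binom{n+1}{k+1}\sum_{\substack{i_1,\dots,i_k\ge 0\\ i_1+\cdots+i_k=n/2}}\frac{\bigl((2N+1)!\bigr)^k}{(2N+2i_1+1)!\cdots(2N+2i_k+1)!}.$$
   Context: For an integer $N\ge 0$, the complementary hypergeometric Euler numbers $\widehat E_{N,n}$ are defined by $$\frac{t^{2N+1}/(2N+1)!}{\sinh t-\sum_{m=0}^{N-1}t^{2m+1}/(2m+1)!}=\sum_{n=0}^\infty\widehat E_{N,n}\frac{t^n}{n!},$$ equivalently $1/\sum_{m\ge0}\frac{(2N+1)!}{(2N+2m+1)!}t^{2m}=\sum_n\widehat E_{N,n}t^n/n!$. The inner sums run over ordered $k$-tuples of integers; when $n$ is odd they are empty (value $0$). *)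

(* Defs.v *)
From mathcomp Require Import all_boot all_order all_algebra.
Set Implicit Arguments.
Unset Strict Implicit.
Unset Printing Implicit Defensive.
Import Order.TTheory GRing.Theory Num.Theory.
Local Open Scope ring_scope.

(* A formal power series over Q is its sequence of ordinary coefficients. *)
Definition fps : Type := nat -> rat.

Definition fps_mul (f g : fps) : fps :=
  fun n => \sum_(i < n.+1) f i * g (n - i)%N.

Definition fps_of_poly (p : {poly rat}) : fps := fun n => p`_n.

(* \sum_n a_n t^n / n! *)
Definition egf (a : nat -> rat) : fps := fun n => a n / n`!%:R.

Definition fps_sinh : fps := egf (fun n => (odd n)%:R).

(* sinh t - \sum_(m < N) t^(2m+1) / (2m+1)! *)
Definition sinh_tail (N : nat) : fps := fun n =>
  fps_sinh n -
  fps_of_poly (\sum_(m < N) ((2 * m + 1)`!%:R)^-1 *: 'X^(2 * m + 1)) n.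

(* The quotient (t^(2N+1) / (2N+1)!) / sinh_tail N is the series S such that
   S * sinh_tail N = t^(2N+1) / (2N+1)!; existence and uniqueness of E are
   proved in compl_hyp_euler_exists and compl_hyp_euler_unique. *)
Definition is_compl_hyp_euler (N : nat) (E : nat -> rat) : Prop :=
  fps_mul (egf E) (sinh_tail N) =1
  fps_of_poly (((2 * N + 1)`!%:R)^-1 *: 'X^(2 * N + 1)).

(* The k-tuples (i_1, ..., i_k) of integers >= lb with i_1 + ... + i_k = n/2.
   The sum condition is written 2 (i_1 + ... + i_k) = n, so that there are none
   for odd n; it forces i_j <= n, so the codomain 'I_n.+1 loses no tuple. *)
Definition half_compositions (lb n k : nat) : {set {ffun 'I_k -> 'I_n.+1}} :=
  [set i : {ffun 'I_k -> 'I_n.+1} |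
    [forall j, lb <= i j]%N && (2 * (\sum_j i j) == n)%N].

Definition composition_sum (lb N n k : nat) : rat :=
  \sum_(i in half_compositions lb n k)
    (2 * N + 1)`!%:R ^+ k / \prod_(j < k) (2 * N + 2 * i j + 1)`!%:R.

Lemma fact_rat_neq0 n : n`!%:R != 0 :> rat.
Proof. by rewrite pnatr_eq0 -lt0n fact_gt0. Qed.

Lemma sinh_tailE N n :
  sinh_tail N n = if odd n && (2 * N < n)%N then (n`!%:R)^-1 else 0.
Proof.
rewrite /sinh_tail /fps_sinh /egf /fps_of_poly coef_sum.
under eq_bigr => m _ do rewrite coefZ coefXn.
have [on|en] := boolP (odd n); last first.
  rewrite mul0r big1 ?subrr // => m _.
  case: eqP => [nm|_]; last by rewrite mulr0.
  by move: en; rewrite nm oddD oddM.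
rewrite mul1r andTb.
have nE : n = (2 * n./2 + 1)%N.
  by rewrite -[LHS]odd_double_half on addnC mul2n.
have ltE m : (2 * m < n)%N = (m <= n./2)%N.
  by rewrite [in LHS]nE addn1 ltnS leq_mul2l.
rewrite ltE; case: leqP => hN.
  rewrite big1 ?subr0 // => m _.
  case: eqP => [nm|_]; last by rewrite mulr0.
  have := leq_trans (ltn_ord m) hN.
  by rewrite nm addnC mul2n (half_bit_double _ true) ltnn.
rewrite (bigD1 (Ordinal hN)) //= -nE eqxx mulr1 big1 ?addr0 ?subrr // => m.
move=> /eqP hm; case: eqP => [nm|_]; last by rewrite mulr0.
case: hm; apply: val_inj => /=.
by rewrite nm addnC mul2n (half_bit_double _ true).
Qed.

Lemma fps_mul_tail N f n :
  fps_mul f (sinh_tail N) (n + (2 * N + 1)) =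
  f n / (2 * N + 1)`!%:R +
  \sum_(i < n) f i * sinh_tail N (n + (2 * N + 1) - i)%N.
Proof.
rewrite /fps_mul -(big_mkord xpredT
  (fun i => f i * sinh_tail N (n + (2 * N + 1) - i)%N)) /=.
rewrite (@big_cat_nat _ _ _ n.+1) //=; last by rewrite ltnS leq_addr.
rewrite [X in _ + X]big_nat_cond [X in _ + X]big1 ?addr0; last first.
  move=> i /andP[/andP[ni _] _]; rewrite sinh_tailE.
  rewrite ltnNge leq_subLR.
  suff -> : (n + (2 * N + 1) <= i + 2 * N)%N by rewrite andbF mulr0.
  by rewrite addn1 addnS -addSn leq_add2r.
rewrite big_nat_recr //= big_mkord addrC addKn sinh_tailE.
by rewrite addn1 /= mul2n odd_double ltnSn.
Qed.

Lemma fps_mul_tail_low N f n :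
  (n < 2 * N + 1)%N -> fps_mul f (sinh_tail N) n = 0.
Proof.
rewrite addn1 ltnS => hn; rewrite /fps_mul big1 // => i _.
rewrite sinh_tailE ltnNge (leq_trans (leq_subr _ _) hn).
by rewrite andbF mulr0.
Qed.

Lemma compl_hyp_eulerP N E :
  is_compl_hyp_euler N E <->
  forall n, fps_mul (egf E) (sinh_tail N) (n + (2 * N + 1)) =
            (n == 0%N)%:R / (2 * N + 1)`!%:R.
Proof.
have eqd n d : (n + d == d)%N = (n == 0%N) by rewrite -{2}[d]add0n eqn_add2r.
split=> [h n|h n].
  by rewrite h /fps_of_poly coefZ coefXn eqd mulrC.
have [hn|hn] := ltnP n (2 * N + 1).
  by rewrite fps_mul_tail_low // /fps_of_poly coefZ coefXn ltn_eqF // mulr0.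
rewrite -(subnK hn) h /fps_of_poly coefZ coefXn.
by rewrite eqd mulrC.
Qed.

Lemma compl_hyp_euler_unique N E F :
  is_compl_hyp_euler N E -> is_compl_hyp_euler N F -> E =1 F.
Proof.
move=> /compl_hyp_eulerP hE /compl_hyp_eulerP hF n.
suff: egf E n = egf F n.
  by move/(mulIf (invr_neq0 (fact_rat_neq0 n))).
elim/ltn_ind: n => n IH.
have := hE n; rewrite -hF !fps_mul_tail.
under eq_bigr => i _ do rewrite IH //.
by move/addIr/(mulIf (invr_neq0 (fact_rat_neq0 _))).
Qed.

Lemma compl_hyp_euler_exists N : exists E, is_compl_hyp_euler N E.
Proof.
pose M : rat := (2 * N + 1)`!%:R.
pose next (s : seq rat) : rat := (size s == 0%N)%:R -
  M * \sum_(i < size s) s`_i * sinh_tail N (size s + (2 * N + 1) - i)%N.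
pose pre n := iter n (fun s => rcons s (next s)) [::].
pose f n := next (pre n).
have szp n : size (pre n) = n by elim: n => //= n IH; rewrite size_rcons IH.
have nthp n i : (i < n)%N -> (pre n)`_i = f i.
  elim: n => // n IH; rewrite ltnS leq_eqVlt => /orP[/eqP ->|hi].
    by rewrite /= nth_rcons szp ltnn eqxx.
  by rewrite /= nth_rcons szp hi IH.
exists (fun n => f n * n`!%:R); apply/compl_hyp_eulerP => n.
have fE i : egf (fun n => f n * n`!%:R) i = f i.
  by rewrite /egf mulfK ?fact_rat_neq0.
rewrite fps_mul_tail fE; under eq_bigr => i _ do rewrite fE.
have -> : f n = (n == 0%N)%:R -
    M * \sum_(i < n) f i * sinh_tail N (n + (2 * N + 1) - i)%N.
  rewrite {1}/f /next szp; congr (_ - M * _); apply: eq_bigr => i _.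
  by rewrite nthp.
by rewrite mulrBl mulrAC mulfV ?fact_rat_neq0 // mul1r subrK.
Qed.

(* Main.v *)
Require Import Defs.
From mathcomp Require Import all_boot all_order all_algebra.
Set Implicit Arguments.
Unset Strict Implicit.
Unset Printing Implicit Defensive.
Import Order.TTheory GRing.Theory Num.Theory.
Local Open Scope ring_scope.

(* Let A = \sum_i (2N+1)! / (2N+2i+1)! t^(2i), so that egf E = 1 / A.  Modulo
   t^(n+1) the power (1 - A)^(n+1) vanishes, hence every polynomial S with
   A S = 1 - (1 - A)^(n+1) has the same n-th coefficient as egf E.  Summing
   the geometric series in 1 - A gives the first formula; expanding
   (1 - A)^(n+1) by the binomial theorem and dividing by A gives the second.
   The composition sums are the coefficients of (A - 1)^k and A^k. *)

Lemma eq_coefMl (R : nzRingType) (p q r : {poly R}) n :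
  (forall i, (i <= n)%N -> p`_i = q`_i) -> (p * r)`_n = (q * r)`_n.
Proof.
move=> pq; rewrite !coefM; apply: eq_bigr => i _.
by rewrite pq // -ltnS ltn_ord.
Qed.

Lemma coef_exp_low (R : comNzRingType) (p : {poly R}) m i :
  p`_0 = 0 -> (i < m)%N -> (p ^+ m)`_i = 0.
Proof.
move=> p0; elim: m i => // m IHm i; rewrite ltnS exprS coefM => le_im.
apply: big1 => -[[|j] /= j_le] _; first by rewrite p0 mul0r.
by rewrite IHm ?mulr0 // (leq_trans _ le_im) // ltn_subrL; case: (i) j_le.
Qed.

(** The [n]-th coefficient of [e * a * s] is computed in two ways; [e] need only invert [a] up to
    degree [n]. *)
Lemma coef_truncated_inverse (R : comNzRingType) (n : nat) (a e s : {poly R}) :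
    a`_0 = 1 ->
    (forall i, (i <= n)%N -> (e * a)`_i = (i == 0%N)%:R) ->
    a * s = 1 - (1 - a) ^+ n.+1 ->
  e`_n = s`_n.
Proof.
move=> a0 ea_eq as_eq.
have: (e * a * s)`_n = (1 * s)`_n.
  by apply: eq_coefMl => i le_in; rewrite ea_eq // coef1.
rewrite mul1r => <-; rewrite -mulrA as_eq mulrC.
(* Since [1 - a] has no constant term, [(1 - a) ^+ n.+1] is invisible up to degree [n]. *)
rewrite (@eq_coefMl _ _ 1) ?mul1r // => i le_in.
by rewrite coefB coef_exp_low ?subr0 // coefB coef1 a0 subrr.
Qed.

Lemma geometric_sum_inverse (R : comNzRingType) (A : comAlgType R) (a : A) n :
  a * (\sum_(0 <= k < n.+1) (-1) ^+ k *: (a - 1) ^+ k) = 1 - (1 - a) ^+ n.+1.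
Proof.
(* Factor [x ^+ n.+1 - 1] at [x = 1 - a], where [x - 1 = - a]. *)
rewrite -(opprB (_ ^+ _)) subrX1 addrAC subrr add0r mulNr opprK big_mkord.
by congr (_ * _); apply: eq_bigr => k _; rewrite -exprZn scaleN1r opprB.
Qed.

Lemma binomial_sum_inverse (R : comNzRingType) (A : comAlgType R) (a : A) n :
  a * (\sum_(0 <= k < n.+1) ((-1) ^+ k * 'C(n.+1, k.+1)%:R) *: a ^+ k)
  = 1 - (1 - a) ^+ n.+1.
Proof.
(* The constant binomial term cancels the 1. Each remaining term contains a factor [a], and
   extracting it shifts the index to [k.+1]. *)
rewrite exprBn big_ord_recl /= !expr1n expr0 !mul1r mulr1n opprD addNKr.
rewrite -sumrN mulr_sumr big_mkord; apply: eq_bigr => k _.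
rewrite expr1n mulr1 /bump /= add1n -scalerAr -exprS.
rewrite [(-1) ^+ _.+1]exprS !mulN1r mulNr mulNrn.
rewrite opprK -scalerA scaler_nat -scalerMnr.
by rewrite -signr_odd scaler_sign -[in RHS]signr_odd mulr_sign.
Qed.

Definition denominator_coef (N i : nat) : rat :=
  (2 * N + 1)`!%:R / (2 * N + 2 * i + 1)`!%:R.

(** A truncation of A for [lb = 0] and of A - 1 for [lb = 1]. The index type ['I_n.+1] is the
    codomain of the tuples in [half_compositions]. *)
Definition denominator_poly (lb N n : nat) : {poly rat} :=
  \sum_(i < n.+1 | (lb <= i)%N) denominator_coef N i *: 'X^(2 * i).

Lemma denominator_poly1 N n :
  denominator_poly 1 N n = denominator_poly 0 N n - 1.
Proof.
rewrite /denominator_poly [in RHS](bigD1 ord0) //= {2}/denominator_coef.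
rewrite muln0 addn0 divff ?fact_rat_neq0 // scale1r expr0 addrAC subrr add0r.
by apply: eq_bigl => i; rewrite lt0n.
Qed.

(** A is [sinh_tail N] divided by its leading term; the truncation does not affect degrees up to
    [n]. *)
Lemma coef_denominator_poly N n j : (j <= n)%N ->
  (denominator_poly 0 N n)`_j =
  (2 * N + 1)`!%:R * sinh_tail N (j + (2 * N + 1))%N.
Proof.
move=> le_jn; rewrite coef_sum sinh_tailE oddD addn1 /= mul2n odd_double addbT.
rewrite addnS ltnS leq_addl andbT.
have [oj|ej] := boolP (odd j).
  rewrite mulr0 big1 // => i _; rewrite coefZ coefXn mul2n.
  by case: eqP oj => [->|]; rewrite ?odd_double ?mulr0.
have jE : j = j./2.*2 by rewrite -[LHS]odd_double_half (negbTE ej).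
have lt_j2 : (j./2 < n.+1)%N.
  by rewrite ltnS (leq_trans _ le_jn) // [leqRHS]jE -addnn leq_addr.
rewrite (bigD1 (Ordinal lt_j2)) //= big1 => [|i i_neq].
  rewrite coefZ coefXn mul2n -jE eqxx mulr1 addr0 /denominator_coef.
  by rewrite !mul2n -jE !addn1 [(j + _)%N]addnC.
rewrite coefZ coefXn mul2n; case: eqP => [ji|]; last by rewrite mulr0.
by case/eqP: i_neq; apply: val_inj; rewrite /= ji doubleK.
Qed.

Lemma composition_sumE lb N n k :
  composition_sum lb N n k = (denominator_poly lb N n ^+ k)`_n.
Proof.
rewrite -[in RHS](card_ord k) -prodr_const /denominator_poly.
(* Expanding the product of [k] sums gives one monomial per function ['I_k -> 'I_n.+1]; its exponent
   is twice the sum of the values. *)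
rewrite bigA_distr_big coef_sum /composition_sum.
rewrite [LHS]big_mkcond [RHS]big_mkcond /=; apply: eq_bigr => f _.
rewrite inE.
have -> : (f \in ffun_on (fun i : 'I_n.+1 => lb <= i)%N)
          = [forall j, lb <= f j]%N by apply/ffun_onP/forallP.
case: [forall j, _] => //=.
rewrite scaler_prod coefZ -(big_morph _ (@exprD _ 'X) (expr0 _)).
rewrite -big_distrr coefXn /= eq_sym; case: eqP => _; last by rewrite mulr0.
by rewrite mulr1 prodf_div prodr_const card_ord.
Qed.

Lemma compl_hyp_euler_denominator N n E (e := \poly_(i < n.+1) egf E i) :
    is_compl_hyp_euler N E ->
  forall m, (m <= n)%N ->
  (e * denominator_poly 0 N n)`_m = (m == 0%N)%:R.
Proof.
move=> /compl_hyp_eulerP hE m le_mn.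
have := hE m; rewrite fps_mul_tail => /(congr1 ( *%R (2 * N + 1)`!%:R)).
rewrite [RHS]mulrC divfK ?fact_rat_neq0 // => <-.
(* The top term of the convolution is split off to match the shape of [fps_mul_tail]. *)
rewrite coefM big_ord_recr /= subnn coef_denominator_poly // add0n.
rewrite [RHS]mulrDr [RHS]addrC; congr (_ + _); last first.
  rewrite coef_poly ltnS le_mn sinh_tailE addn1 /= mul2n odd_double ltnSn.
  by rewrite mulrCA.
rewrite mulr_sumr; apply: eq_bigr => i _.
have le_im := ltnW (ltn_ord i).
rewrite coef_poly ltnS (leq_trans le_im le_mn) coef_denominator_poly.
  by rewrite mulrCA addnBAC.
by rewrite (leq_trans (leq_subr _ _) le_mn).
Qed.

Theorem theorem5 (N n : nat) (E : nat -> rat)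
    (hE : is_compl_hyp_euler N E) (hn : (1 <= n)%N) :
  E n = n`!%:R *
    \sum_(1 <= k < n.+1) (-1) ^+ k * composition_sum 1 N n k
  /\
  E n = n`!%:R *
    \sum_(1 <= k < n.+1)
      (-1) ^+ k * 'C(n.+1, k.+1)%:R * composition_sum 0 N n k.
Proof.
set a := denominator_poly 0 N n.
have a0 : a`_0 = 1.
  rewrite coef_denominator_poly // sinh_tailE add0n addn1 /= mul2n odd_double.
  by rewrite ltnSn divff ?fact_rat_neq0.
have coef_inverse s : a * s = 1 - (1 - a) ^+ n.+1 -> E n = n`!%:R * s`_n.
  move=> /(coef_truncated_inverse a0 (compl_hyp_euler_denominator hE)) <-.
  by rewrite coef_poly ltnSn mulrC divfK ?fact_rat_neq0.
have coef_sum_pow (c : nat -> rat) (p : {poly rat}) :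
    (\sum_(0 <= k < n.+1) c k *: p ^+ k)`_n =
    \sum_(1 <= k < n.+1) c k * (p ^+ k)`_n.
  (* The term [k = 0] is a constant polynomial, so it contributes nothing in degree [n >= 1]. *)
  rewrite big_ltn // coefD coefZ coef1 eqn0Ngt hn mulr0 add0r coef_sum.
  by apply: eq_bigr => k _; rewrite coefZ.
split.
- rewrite (coef_inverse _ (geometric_sum_inverse a n)) coef_sum_pow.
  congr (_ * _); apply: eq_bigr => k _.
  by rewrite composition_sumE denominator_poly1.
- rewrite (coef_inverse _ (binomial_sum_inverse a n)) coef_sum_pow.
  by congr (_ * _); apply: eq_bigr => k _; rewrite composition_sumE.
Qed.
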